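(* Let $d$ be even, let $\Lambda=(\lambda_1,\mu_1,\lambda_2,\mu_2,\lambda_3,\dots,\lambda_{(d+2)/2})$ be a tuple of partitions of total size $n$, and let $-\mathrm{Id}\in W_n\subset C_d^n\rtimes W_n$ be the longest element of $W_n$ (so $\widetilde{w_0}=-\mathrm{Id}$ in types $B$ and $C$). (a) If $\lambda_j\neq\emptyset$ for some $j>2$, then $\chi_\Lambda^0(-\mathrm{Id})=0$. (b) If $\lambda_j=\emptyset$ for all $j>2$, then $$\chi_\Lambda^0(-\mathrm{Id})=\frac{n!}{|\lambda_1|!\,|\mu_1|!\,|\lambda_2|!\,|\mu_2|!}\,(-1)^{|\mu_1|+|\mu_2|}\;\mathbb S^{\lambda_1}(1)\,\mathbb S^{\mu_1}(1)\,\mathbb S^{\lambda_2}(1)\,\mathbb S^{\mu_2}(1).$$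
   Context: $C_d$ is the group of $d$-th roots of unity. $W_n=\{\pm1\}^n\rtimes\mathbb S_n$ is the group of $n\times n$ signed permutation matrices; it acts on $C_d^n$ by permuting coordinates, with a diagonal element inverting the coordinates where it has entry $-1$. $\mathbb S^\lambda$ is the irreducible character of $\mathbb S_{|\lambda|}$ attached to $\lambda$. For partitions $\lambda,\mu$ with $|\lambda|+|\mu|=m$, $\chi_{\lambda,\mu}=\mathrm{Ind}_{W_{|\lambda|}\times W_{|\mu|}}^{W_m}\mathbb S^\lambda\otimes(\mathbb S^\mu\otimes\mathrm{sgn})$, with $\mathbb S^\lambda,\mathbb S^\mu$ inflated along $W_k\to\mathbb S_k$ and $\mathrm{sgn}(t_1,\dots,t_k,\sigma)=t_1\cdots t_k$. Put $n_i=|\lambda_i|+|\mu_i|$ for $i=1,2$ and $n_i=|\lambda_i|$ for $i>2$; $N_i=C_d^{n_i}\rtimes W_{n_i}$ for $i=1,2$ and $N_i=C_d^{n_i}\rtimes\mathbb S_{n_i}$ for $i>2$. Let $\psi_1$ be the trivial character of $C_d$, $\psi_2:x\mapsto x^{d/2}$, $\psi_i:x\mapsto x^{i-2}$ for $i>2$. Then $$\chi_\Lambda^0=\mathrm{Ind}_{\prod N_i}^{C_d^n\rtimes W_n}\Bigl((\chi_{\lambda_1,\mu_1}\otimes\psi_1)\otimes(\chi_{\lambda_2,\mu_2}\otimes\psi_2)\otimes\bigotimes_{i>2}(\mathbb S^{\lambda_i}\otimes\psi_i)\Bigr),$$ where $\psi_i$ acts on $(t_1,\dots,t_{n_i})\in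 C_d^{n_i}$ by $\psi_i(t_1\cdots t_{n_i})$ (extended trivially to $W_{n_i}$ or $\mathbb S_{n_i}$). These are the irreducible characters of $S_{d,n}=C_d^n\rtimes W_n$ in types $B$ and $C$. *)

(* Defs.v *)
From HB Require Import structures.
From mathcomp Require Import all_boot all_order all_algebra all_fingroup.
From mathcomp Require Import all_solvable all_field all_character.

Set Implicit Arguments.
Unset Strict Implicit.
Unset Printing Implicit Defensive.

Import Order.TTheory GRing.Theory Num.Theory.
Local Open Scope ring_scope.

(* The group C_d of d-th roots of unity. The exponent d.-1.+1 is d when d > 0,
   and makes the type finite also for d = 0. *)
Record rou (d : nat) := Rou {rou_val :> algC; rouP : rou_val ^+ d.-1.+1 == 1}.

HB.instance Definition _ d := [isSub for @rou_val d].
HB.instance Definition _ d := [Choice of rou d by <:].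

Section RootsOfUnity.
Variable d : nat.

Let z : algC := sval (C_prim_root_exists (ltn0Sn d.-1)).
Let z_prim : d.-1.+1.-primitive_root z :=
  svalP (C_prim_root_exists (ltn0Sn d.-1)).

Fact rou_exp_subproof (i : 'I_d.-1.+1) : (z ^+ i) ^+ d.-1.+1 == 1.
Proof. by rewrite exprAC (prim_expr_order z_prim) expr1n. Qed.

Definition rou_exp i := Rou (rou_exp_subproof i).
Definition rou_log (x : rou d) : 'I_d.-1.+1 :=
  sval (prim_rootP z_prim (eqP (rouP x))).

Fact rou_logK : cancel rou_log rou_exp.
Proof.
move=> x; apply: val_inj => /=; rewrite /rou_log.
by case: (prim_rootP _ _).
Qed.

HB.instance Definition _ :=
  isCountable.Build (rou d) (pcan_pickleK (can_pcan rou_logK)).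
HB.instance Definition _ :=
  isFinite.Build (rou d) (pcan_enumP (can_pcan rou_logK)).

Fact rou1_subproof : (1 : algC) ^+ d.-1.+1 == 1. Proof. by rewrite expr1n. Qed.
Definition rou1 := Rou rou1_subproof.

Fact rouM_subproof (x y : rou d) : ((x : algC) * y) ^+ d.-1.+1 == 1.
Proof. by rewrite exprMn (eqP (rouP x)) (eqP (rouP y)) mulr1. Qed.
Definition rouM x y := Rou (rouM_subproof x y).

Fact rouV_subproof (x : rou d) : (x : algC)^-1 ^+ d.-1.+1 == 1.
Proof. by rewrite exprVn (eqP (rouP x)) invr1. Qed.
Definition rouV x := Rou (rouV_subproof x).

Fact rou_neq0 (x : rou d) : (x : algC) != 0.
Proof.
by apply/eqP=> x0; have:= rouP x; rewrite x0 expr0n /= eq_sym oner_eq0.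
Qed.

Fact rouMA : associative rouM.
Proof. by move=> x y t; apply: val_inj; rewrite /= mulrA. Qed.
Fact rouM1 : left_id rou1 rouM.
Proof. by move=> x; apply: val_inj; rewrite /= mul1r. Qed.
Fact rouMV : left_inverse rou1 rouV rouM.
Proof. by move=> x; apply: val_inj; rewrite /= mulVf ?rou_neq0. Qed.

HB.instance Definition _ := Finite_isGroup.Build (rou d) rouMA rouM1 rouMV.

End RootsOfUnity.

(* C_d^n *)
Notation Cpow d n := {dffun forall _ : 'I_n, rou d}.

Section ExternalSemidirectProduct.
Variables (aT rT : finGroupType).
Variable to : groupAction [set: aT] [set: rT].

Fact sdmk_subproof (a : aT) (x : rT) : (a, x) \in setX [set: aT] [set: rT].
Proof. by rewrite !inE. Qed.
Definition sdmk a x : sdprod_by to := SdPair to (sdmk_subproof a x).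

Lemma sdpair1E x : sdpair1 to x = (1%g, x) :> aT * rT.
Proof. by rewrite -[LHS]/(val _) val_insubd !inE. Qed.

Lemma sdpair2E a : sdpair2 to a = (a, 1%g) :> aT * rT.
Proof. by rewrite -[LHS]/(val _) val_insubd !inE. Qed.

Lemma sd_eq (u v : sdprod_by to) : u.1 = v.1 -> u.2 = v.2 -> u = v.
Proof.
by case: u v => [[a x] ?] [[b y] ?] /= ea ex; apply/val_inj/pair_equal_spec.
Qed.

Definition sdtop (u : sdprod_by to) : aT := u.1.
Lemma sdtopM : {in setT &, {morph sdtop : u v / (u * v)%g}}.
Proof. by []. Qed.
Canonical sdtop_morphism := Morphism sdtopM.

End ExternalSemidirectProduct.

Section Groups.

Definition permC d n (c : Cpow d n) (s : 'S_n) : Cpow d n :=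
  [ffun i => c ((s^-1)%g i)].

Variables (d n : nat).

Lemma permC1 : (@permC d n)^~ 1%g =1 id.
Proof. by move=> c; apply/ffunP=> i; rewrite ffunE invg1 perm1. Qed.

Lemma permCM (c : Cpow d n) : act_morph (@permC d n) c.
Proof. by move=> s t; apply/ffunP=> i; rewrite !ffunE invMg permM. Qed.

Definition permC_action := TotalAction permC1 permCM.

Lemma permC_is_groupAction : is_groupAction [set: Cpow d n] permC_action.
Proof.
move=> s _; rewrite inE; apply/andP; split.
  by apply/subsetP=> c; rewrite !inE.
by apply/morphicP=> c e _ _; apply/ffunP=> i; rewrite !actpermE !ffunE.
Qed.

Definition permC_groupAction := GroupAction permC_is_groupAction.

End Groups.

(* W_n = {+1,-1}^n ><| S_n, where {+1,-1} = C_2. An element w is a pair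
   (w.1, w.2) standing for the product w.1 w.2 of the permutation w.1 : 'S_n
   and the diagonal element w.2; permutations compose from left to right and
   act on the right. See signed_mx below for the associated matrix. *)
Definition W n := sdprod_by (permC_groupAction 2 n).
HB.instance Definition _ n := FinGroup.on (W n).

Definition roupow d (t : rou 2) (x : rou d) : rou d :=
  if t == 1%g then x else x^-1%g.

Lemma rou2_mul (s t : rou 2) : s != 1%g -> t != 1%g -> (s * t)%g = 1%g.
Proof.
have rou2N1 (u : rou 2) : u != 1%g -> rou_val u = -1.
  move=> u1; have := rouP u; rewrite sqrf_eq1 => /orP[] /eqP // u_1.
  by case/eqP: u1; apply: val_inj.
by move=> /rou2N1 s1 /rou2N1 t1; apply: val_inj; rewrite /= s1 t1 mulrNN mulr1.
Qed.

Lemma rouC d (x y : rou d) : (x * y = y * x)%g.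
Proof. by apply: val_inj; rewrite /= mulrC. Qed.

Lemma roupowM d (s t : rou 2) (x : rou d) :
  roupow (s * t)%g x = roupow t (roupow s x).
Proof.
rewrite /roupow; have [->|s1] := eqVneq s 1%g; first by rewrite mul1g.
have [->|t1] := eqVneq t 1%g; first by rewrite mulg1 (negPf s1).
by rewrite rou2_mul // eqxx invgK.
Qed.

Lemma roupow_morph d t : {morph @roupow d t : x y / (x * y)%g}.
Proof. by move=> x y; rewrite /roupow; case: ifP; rewrite // invMg rouC. Qed.

Section SignedAction.

Variables (d n : nat).

(* A signed permutation permutes the coordinates, then inverts those where its
   diagonal part is -1. *)
Definition actW (c : Cpow d n) (w : W n) : Cpow d n :=
  [ffun i => roupow (w.2 i) (permC c w.1 i)].

Lemma actW1 : actW^~ 1%g =1 id.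
Proof.
by move=> c; apply/ffunP=> i; rewrite !ffunE /roupow eqxx invg1 perm1.
Qed.

Lemma actWM (c : Cpow d n) : act_morph actW c.
Proof.
move=> v w; apply/ffunP=> i.
by rewrite !ffunE /= roupowM invMg permM.
Qed.

Definition actW_action := TotalAction actW1 actWM.

Lemma actW_is_groupAction : is_groupAction [set: Cpow d n] actW_action.
Proof.
move=> w _; rewrite inE; apply/andP; split.
  by apply/subsetP=> c; rewrite !inE.
apply/morphicP=> b c _ _; apply/ffunP=> i.
by rewrite !actpermE !ffunE roupow_morph.
Qed.

Definition actW_groupAction := GroupAction actW_is_groupAction.

End SignedAction.

(* S_{d,n} = C_d^n ><| W_n; x : Sdn d n stands for x.1 x.2 with x.1 : W n and
   x.2 : C_d^n. *)
Definition Sdn d n := sdprod_by (actW_groupAction d n).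
HB.instance Definition _ d n := FinGroup.on (Sdn d n).

Fact rouN1_subproof : (-1 : algC) ^+ 2 == 1.
Proof. by rewrite sqrrN expr1n. Qed.
Definition rouN1 : rou 2 := Rou (rouN1_subproof : _ ^+ 2.-1.+1 == 1).

Definition negIdW n : W n :=
  sdpair1 (permC_groupAction 2 n) [ffun=> rouN1].
Definition negId d n : Sdn d n := sdpair2 (actW_groupAction d n) (negIdW n).

(* The signed permutation matrix of w, acting on row vectors *)
Definition signed_mx n (w : W n) : 'M[algC]_n :=
  \matrix_(i, j) (rou_val (w.2 j) *+ (w.1 i == j)).

Lemma W_mulE n (v w : W n) (i : 'I_n) :
  (v * w)%g.2 i = (v.2 ((w.1^-1)%g i) * w.2 i)%g.
Proof. by rewrite /= !ffunE. Qed.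

Lemma Sdn_mulE d n (x y : Sdn d n) (i : 'I_n) :
  (x * y)%g.2 i = (roupow (y.1.2 i) (x.2 ((y.1.1^-1)%g i)) * y.2 i)%g.
Proof. by rewrite /= !ffunE. Qed.

Lemma signed_mxM n (v w : W n) :
  signed_mx (v * w)%g = signed_mx v *m signed_mx w.
Proof.
apply/matrixP=> i j; rewrite !mxE (bigD1 (v.1 i)) //= big1 => [|k /negPf ki].
  rewrite !mxE eqxx addr0 permM W_mulE.
  by case: eqP => [<-|_]; rewrite ?mulr0n ?mulr0 // permK.
by rewrite !mxE eq_sym ki mul0r.
Qed.

Lemma signed_mx_inj n : injective (@signed_mx n).
Proof.
move=> [[s t] st] [[s' t'] st'] /matrixP/= eqm; apply: val_inj => /=.
have eqs: s = s'.
  apply/permP=> i; have := eqm i (s i); rewrite !mxE /= eqxx.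
  case: eqP => [-> //|_ /eqP]; by rewrite mulr1n mulr0n (negPf (rou_neq0 _)).
congr (_, _) => //; apply/ffunP=> j; apply: val_inj.
by have := eqm (s^-1%g j) j; rewrite !mxE /= -eqs permKV eqxx.
Qed.

Lemma signed_mx_negIdW n : signed_mx (negIdW n) = - 1%:M.
Proof.
apply/matrixP=> i j; rewrite !mxE.
by rewrite /negIdW sdpair1E perm1 ffunE mulNrn.
Qed.

(* Cutting 'I_n into blocks of sizes p i, numbered by enum_rank; another
   numbering would give conjugate embeddings below. *)
Section Blocks.

Variables (I : finType) (p : I -> nat) (n : nat).
Hypothesis sum_p : (\sum_i p i)%N = n.

Fact card_block : #|{: {i : I & 'I_(p i)}}| = n.
Proof.
rewrite card_tagged -sum_p sumnE big_map big_enum /=.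
by apply: eq_bigr => i _; rewrite card_ord.
Qed.

Definition block_pos i (j : 'I_(p i)) : 'I_n :=
  cast_ord card_block (enum_rank (Tagged (fun i => 'I_(p i)) j)).
Definition block_of (k : 'I_n) : {i : I & 'I_(p i)} :=
  enum_val (cast_ord (esym card_block) k).

Lemma block_posK i (j : 'I_(p i)) :
  block_of (block_pos j) = Tagged (fun i => 'I_(p i)) j.
Proof. by rewrite /block_of cast_ordK enum_rankK. Qed.

Lemma block_ofK k : block_pos (tagged (block_of k)) = k.
Proof.
rewrite /block_pos (_ : Tagged _ _ = block_of k); last by case: (block_of k).
by rewrite enum_valK cast_ordKV.
Qed.

Lemma block_ind (P : 'I_n -> Prop) :
  (forall i (j : 'I_(p i)), P (block_pos j)) -> forall k, P k.
Proof. by move=> Pp k; rewrite -(block_ofK k). Qed.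

Definition block_permf (s : forall i, 'S_(p i)) (k : 'I_n) : 'I_n :=
  block_pos (s (tag (block_of k)) (tagged (block_of k))).

Fact block_permf_inj s : injective (block_permf s).
Proof.
apply: (can_inj (g := block_permf (fun i => (s i)^-1%g))) => k.
by rewrite /block_permf block_posK /= permK block_ofK.
Qed.

Definition block_perm s : 'S_n := perm (@block_permf_inj s).

Definition block_tuple d (c : forall i, Cpow d (p i)) : Cpow d n :=
  [ffun k => c (tag (block_of k)) (tagged (block_of k))].

Definition block_W (w : forall i, W (p i)) : W n :=
  sdmk (permC_groupAction 2 n) (block_perm (fun i => (w i).1))
       (block_tuple (fun i => (w i).2)).

Definition block_Sdn d (x : forall i, Sdn d (p i)) : Sdn d n :=
  sdmk (actW_groupAction d n) (block_W (fun i => (x i).1))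
       (block_tuple (fun i => (x i).2)).

Lemma block_permE s i (j : 'I_(p i)) :
  block_perm s (block_pos j) = block_pos (s i j).
Proof. by rewrite permE /block_permf block_posK. Qed.

Lemma block_permVE s i (j : 'I_(p i)) :
  (block_perm s)^-1%g (block_pos j) = block_pos ((s i)^-1%g j).
Proof. by apply: (canLR (permK _)); rewrite block_permE permKV. Qed.

Lemma block_tupleE d c i (j : 'I_(p i)) :
  block_tuple c (block_pos j) = c i j :> rou d.
Proof. by rewrite ffunE block_posK. Qed.

Lemma block_pos_inj i : injective (@block_pos i).
Proof.
move=> j k ejk; have := block_posK j; rewrite ejk block_posK.
by move/eqP; rewrite -tag_eqE /tag_eq eqxx /= tagged_asE => /eqP.
Qed.

Lemma block_WM (u v w : forall i, W (p i)) :
  (forall i, u i = (v i * w i)%g) -> block_W u = (block_W v * block_W w)%g.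
Proof.
move=> uE; apply: val_inj; rewrite /block_W /=; congr (_, _).
  apply/permP; apply: block_ind => i j.
  by rewrite permM !block_permE uE permM.
apply/ffunP; apply: block_ind => i j.
rewrite block_tupleE uE W_mulE.
by rewrite /= mulg_ffun block_tupleE ffunE block_permVE block_tupleE.
Qed.

Lemma block_W_inj (v w : forall i, W (p i)) :
  block_W v = block_W w -> forall i, v i = w i.
Proof.
move=> /(congr1 val); rewrite /block_W /= => -[eqs eqt] i; apply: sd_eq.
  apply/permP=> j; apply: (@block_pos_inj i).
  by have /permP/(_ (block_pos j)) := eqs; rewrite !block_permE.
by apply/ffunP=> j; have /ffunP/(_ (block_pos j)) := eqt; rewrite !block_tupleE.
Qed.

Lemma block_SdnM d (u v w : forall i, Sdn d (p i)) :
  (forall i, u i = (v i * w i)%g) ->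
  block_Sdn u = (block_Sdn v * block_Sdn w)%g.
Proof.
move=> uE; apply: val_inj; rewrite /block_Sdn /=; congr (_, _).
  by apply: block_WM => i; rewrite uE.
apply/ffunP; apply: block_ind => i j.
rewrite block_tupleE uE Sdn_mulE.
by rewrite /= mulg_ffun block_tupleE !ffunE block_permVE !block_posK.
Qed.

Lemma block_Sdn_inj d (v w : forall i, Sdn d (p i)) :
  block_Sdn v = block_Sdn w -> forall i, v i = w i.
Proof.
move=> /(congr1 val); rewrite /block_Sdn /= => eqx i.
have eqt := congr1 snd eqx.
apply: sd_eq; first exact: block_W_inj (congr1 fst eqx) i.
by apply/ffunP=> j; have /ffunP/(_ (block_pos j)) := eqt; rewrite !block_tupleE.
Qed.

(* prod_i S_{d,p i} -> S_{d,n}, the block-diagonal embedding *)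
Definition block_emb d (x : {dffun forall i, Sdn d (p i)}) := block_Sdn x.

Lemma block_embM d : {in setT &, {morph @block_emb d : x y / (x * y)%g}}.
Proof. by move=> x y _ _; apply: block_SdnM => i; rewrite mulg_ffun. Qed.
Canonical block_emb_morphism d := Morphism (@block_embM d).

Lemma injm_block_emb d : ('injm (@block_emb d))%g.
Proof. by apply/injmP=> x y _ _ /block_Sdn_inj exy; apply/ffunP. Qed.

End Blocks.

(* W_k x W_l -> W_m for k + l = m *)
Section PairEmbedding.

Variables (k l m : nat) (klm : (k + l)%N = m).

Definition pair_size (b : bool) := if b then k else l.

Lemma sum_pair_size : (\sum_b pair_size b)%N = m.
Proof. by rewrite big_bool. Qed.

Definition pair_fun (x : W k * W l) (b : bool) : W (pair_size b) :=
  if b as b0 return W (pair_size b0) then x.1 else x.2.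

Definition pair_emb (x : W k * W l) : W m :=
  block_W sum_pair_size (pair_fun x).

Lemma pair_embM : {in setT &, {morph pair_emb : x y / (x * y)%g}}.
Proof. by move=> x y _ _; apply: block_WM; case. Qed.
Canonical pair_emb_morphism := Morphism pair_embM.

Lemma injm_pair_emb : ('injm pair_emb)%g.
Proof.
apply/injmP=> -[x1 x2] [y1 y2] _ _ /block_W_inj exy.
by congr (_, _); [apply: (exy true) | apply: (exy false)].
Qed.

End PairEmbedding.

Section ClassFunctions.

Variables (aT rT : finGroupType).

(* The class function x |-> phi (f x) on G, meaningful when G is contained in
   the domain of f and f @* G is contained in H. *)
Definition cfPull (D : {group aT}) (f : {morphism D >-> rT})
    (G : {group aT}) (H : {group rT}) (phi : 'CF(H)) : 'CF(G) :=
  cfMorph ('Res[(f @* G)%g, H] phi).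

Lemma cfPullE (D : {group aT}) (f : {morphism D >-> rT})
    (G : {group aT}) (H : {group rT}) (phi : 'CF(H)) x :
  G \subset D -> (f @* G)%g \subset H -> x \in G ->
  cfPull f G phi x = phi (f x).
Proof.
move=> sGD sfGH Gx.
by rewrite cfMorphE // cfResE // mem_morphim // (subsetP sGD).
Qed.

(* Induction along an embedding f of G in rT *)
Definition cfIndEmb (G : {group aT}) (f : {morphism G >-> rT})
    (injf : ('injm f)%g) (phi : 'CF(G)) : 'CF([set: rT]%G) :=
  'Ind[[set: rT]%G, (f @* G)%G] (cfIsom (sub_isom (subxx G) erefl injf) phi).

Fact cfLin_subproof (G : {group rT}) (f : rT -> algC) :
    f 1%g = 1 -> {in G &, forall x y, f (x * y)%g = f x * f y} ->
  is_class_fun <<G>>%g [ffun x => f x *+ (x \in G)].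
Proof.
move=> f1 fM; rewrite genGid.
apply: intro_class_fun => [x y Gx Gy|x /negPf-> //].
rewrite Gx groupJ // conjgE !fM ?groupM ?groupV // mulrC -mulrA -fM ?groupV //.
by rewrite mulgV f1 mulr1.
Qed.

(* The linear character of G given by a multiplicative map f *)
Definition cfLin (G : {group rT}) f f1 fM : 'CF(G) :=
  Cfun 1 (@cfLin_subproof G f f1 fM).

Lemma cfLinE (G : {group rT}) f f1 fM x : x \in G -> @cfLin G f f1 fM x = f x.
Proof. by move=> Gx; rewrite cfunElock Gx. Qed.

End ClassFunctions.

Record intpart := IntPart {
  parts :> seq nat;
  intpartP : sorted geq parts && (0%N \notin parts) }.

Definition psize (lam : intpart) : nat := sumn lam.

Section Specht.

Variable lam : intpart.
Local Notation n := (psize lam).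
Local Notation SG := [set: 'S_n]%G.

(* The cells of the diagram of lam are numbered 0, ..., n - 1 row by row: cell
   k lies in row reshape_index lam k and column reshape_offset lam k. *)
Definition row_stab : {set 'S_n} :=
  [set s : 'S_n | [forall k : 'I_n,
     reshape_index lam (s k) == reshape_index lam k]].
Definition col_stab : {set 'S_n} :=
  [set s : 'S_n | [forall k : 'I_n,
     reshape_offset lam (s k) == reshape_offset lam k]].

(* The Young symmetrizer, as a row vector over the group basis of the group
   algebra. As (q * p)%g is the permutation p o q, this is
   sum_(p, q) sgn(q) (p o q). *)
Definition young_sym : 'rV[algC]_#|SG| :=
  \sum_(p in row_stab) \sum_(q in col_stab)
     (-1) ^+ odd_perm q *: delta_mx 0 (gring_index SG (q * p)%g).

(* The Specht module: the submodule of the regular module generated by the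
   Young symmetrizer. *)
Definition specht : 'CF(SG) :=
  cfRepr (submod_repr
    (cyclic_mx_module (regular_repr algC SG) young_sym)).

End Specht.

Section HyperoctahedralCharacters.

(* Inflation of S^lam along W_k -> S_k *)
Definition infl (lam : intpart) : 'CF([set: W (psize lam)]%G) :=
  cfPull (@sdtop_morphism _ _ (permC_groupAction 2 (psize lam))) _ (specht lam).

Definition sgn_fun k (w : W k) : algC := rou_val (\prod_i w.2 i)%g.

Lemma rou_val_prod d n (c : Cpow d n) :
  rou_val (\prod_i c i)%g = \prod_i rou_val (c i).
Proof. exact: (big_morph (@rou_val d)). Qed.

Lemma sgn_fun1 k : sgn_fun (1%g : W k) = 1.
Proof.
by rewrite /sgn_fun rou_val_prod big1 // => i _; rewrite /= oneg_ffun.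
Qed.

Lemma sgn_funM k :
  {in [set: W k] &, forall v w, sgn_fun (v * w)%g = sgn_fun v * sgn_fun w}.
Proof.
move=> v w _ _; rewrite /sgn_fun !rou_val_prod.
under eq_bigr do rewrite W_mulE /=.
rewrite big_split /=; congr (_ * _).
by rewrite [RHS](reindex_inj (@perm_inj _ (w.1)^-1%g)).
Qed.

Definition sgnW k : 'CF([set: W k]%G) := cfLin (@sgn_fun1 k) (@sgn_funM k).

(* chi_{lam, mu} *)
Definition chiW (lam mu : intpart) : 'CF([set: W (psize lam + psize mu)]%G) :=
  cfIndEmb (injm_pair_emb (erefl (psize lam + psize mu)%N))
    (cfPull (@fst_morphism (W (psize lam)) (W (psize mu))) _ (infl lam) *
     cfPull (@snd_morphism (W (psize lam)) (W (psize mu))) _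
       (infl mu * sgnW (psize mu))).

End HyperoctahedralCharacters.

Section LinearCharacters.

Variables (d n : nat).

(* C_d^n ><| S_n, as a subgroup of C_d^n ><| W_n *)
Definition SdnS : {group Sdn d n} :=
  (@sdtop _ _ (actW_groupAction d n) @*^-1
     (sdpair2 (permC_groupAction 2 n) @* [set: 'S_n]))%G.

Definition psi_fun (e : nat) (x : Sdn d n) : algC :=
  rou_val (\prod_i x.2 i)%g ^+ e.

Lemma psi_fun1 e : psi_fun e 1%g = 1.
Proof.
rewrite /psi_fun rou_val_prod big1 ?expr1n // => i _.
by rewrite /= oneg_ffun.
Qed.

Lemma psi_funM_aux e (x y : Sdn d n) :
  (forall i, rou_val (roupow (y.1.2 i) (x.2 ((y.1.1)^-1%g i))) ^+ e =
             rou_val (x.2 ((y.1.1)^-1%g i)) ^+ e) ->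
  psi_fun e (x * y)%g = psi_fun e x * psi_fun e y.
Proof.
move=> eH; rewrite /psi_fun !rou_val_prod -!prodrXl.
under eq_bigr do rewrite Sdn_mulE /= exprMn eH.
rewrite big_split /=; congr (_ * _).
by rewrite [RHS](reindex_inj (@perm_inj _ (y.1.1)^-1%g)).
Qed.

Lemma psi_funM_W e : (d.-1.+1 %| e.*2)%N ->
  {in [set: Sdn d n]%G &,
    forall x y, psi_fun e (x * y)%g = psi_fun e x * psi_fun e y}.
Proof.
move=> /dvdnP[m eE] x y _ _; apply: psi_funM_aux => i.
rewrite /roupow; case: ifP => //= _; set r := x.2 _.
rewrite exprVn; apply: (mulfI (expf_neq0 e (rou_neq0 r))).
rewrite divff ?expf_neq0 ?rou_neq0 //.
by rewrite -exprD addnn eE mulnC exprM (eqP (rouP r)) expr1n.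
Qed.

Lemma psi_funM_S e :
  {in SdnS &, forall x y, psi_fun e (x * y)%g = psi_fun e x * psi_fun e y}.
Proof.
move=> x y _ /morphpreP[_ /morphimP[s _ _ ys]]; apply: psi_funM_aux => i.
rewrite -[y.1]/(sdtop y) ys [X in X.2](sdpair2E _ s) /=.
by rewrite oneg_ffun /roupow eqxx.
Qed.

Definition psiW e (he : (d.-1.+1 %| e.*2)%N) : 'CF([set: Sdn d n]%G) :=
  cfLin (psi_fun1 e) (psi_funM_W he).
Definition psiS e : 'CF(SdnS) := cfLin (psi_fun1 e) (@psi_funM_S e).

(* Inflation along C_d^n ><| W_n -> W_n, restricted to G *)
Definition inflW (G : {group Sdn d n}) (phi : 'CF([set: W n]%G)) : 'CF(G) :=
  cfPull (@sdtop_morphism _ _ (actW_groupAction d n)) G phi.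

End LinearCharacters.

(* (lam1, mu1, lam2, mu2, lam_3, ..., lam_(k+2)), with lam_(j+3) = lams j *)
Record multipartition (k : nat) := Multipartition {
  lam1 : intpart; mu1 : intpart;
  lam2 : intpart; mu2 : intpart;
  lams : 'I_k -> intpart }.

Definition msize k (L : multipartition k) : nat :=
  (psize (lam1 L) + psize (mu1 L) + psize (lam2 L) + psize (mu2 L)
   + \sum_j psize (lams L j))%N.

Section MainCharacter.

Variables (d : nat) (d_even : ~~ odd d) (L : multipartition d./2.-1).

(* inl true is the block 1, inl false is the block 2, inr j is the block j+3 *)
Notation block := (bool + 'I_d./2.-1)%type.

Definition bsize (i : block) : nat :=
  match i with
  | inl true => psize (lam1 L) + psize (mu1 L)
  | inl false => psize (lam2 L) + psize (mu2 L)
  | inr j => psize (lams L j)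
  end.

Definition bgroup (i : block) : {group Sdn d (bsize i)} :=
  match i with
  | inl _ => [set: Sdn d _]%G
  | inr j => SdnS d _
  end.

Fact psi1_dvd : (d.-1.+1 %| 0.*2)%N. Proof. exact: dvdn0. Qed.
Fact psi2_dvd : (d.-1.+1 %| d./2.*2)%N.
Proof. by rewrite even_halfK //; case: d => [|d'] //=. Qed.

(* The exponents of psi are 0, d/2 and, for the block j+3, (j+3)-2 = j+1. *)
Definition bchar (i : block) : 'CF(bgroup i) :=
  match i return 'CF(bgroup i) with
  | inl true => inflW _ (chiW (lam1 L) (mu1 L)) * psiW _ psi1_dvd
  | inl false => inflW _ (chiW (lam2 L) (mu2 L)) * psiW _ psi2_dvd
  | inr j => inflW _ (infl (lams L j)) * psiS d _ j.+1
  end.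

Variables (n : nat) (size_L : msize L = n).

Lemma sum_bsize : (\sum_i bsize i)%N = n.
Proof. by rewrite -size_L big_sumType /= big_bool /= /msize !addnA. Qed.

Definition bemb :=
  restrm (subsetT (setXn bgroup)) (@block_emb _ _ _ sum_bsize d).

Fact injm_bemb : ('injm bemb)%g.
Proof. by rewrite injm_restrm // injm_block_emb. Qed.

Definition chi0 : 'CF([set: Sdn d n]%G) :=
  cfIndEmb injm_bemb
    (\prod_i cfPull (@dffun_morphism _ _ i) [group of setXn bgroup] (bchar i)).

End MainCharacter.

(* Main.v *)
Require Import Defs.
From mathcomp Require Import all_boot all_order all_algebra all_fingroup.
From mathcomp Require Import all_solvable all_field all_character.
From mathcomp Require Import ring.

Set Implicit Arguments.
Unset Strict Implicit.
Unset Printing Implicit Defensive.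

Import Order.TTheory GRing.Theory Num.Theory.
Local Open Scope ring_scope.

(** The element [- Id] is central in [W_n] and inverts [C_d^n], so its
    conjugate by [y] is [- Id] times the square of the [C_d^n]-component of [y]
    ([negId_conj]). As [chi_Lambda^0] is an induced character, its value at
    [- Id] is a sum, over these conjugates, of values of the inducing character.

    If some [lambda_j] with [j > 2] is nonempty, no conjugate meets the
    inducing subgroup, whose elements have a positive sign on the block [j],
    while [- Id] times a square has only negative signs; the sum is [0]
    ([chi0_negId_eq0]).

    Otherwise every conjugate lies in the inducing subgroup, and the inducing
    character takes the same value at all of them: the linear characters
    [psi_1] and [psi_2] have order at most 2, so they are trivial on squares
    ([psi_fun_neg_sq]), and what remains is the product of the values of the
    two hyperoctahedral characters at [- Id]. The induced character is then
    this constant times an index, which is the binomial coefficient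
    [n! / (n_1! n_2!)] as the powers of the orders of [C_d] and [C_2] cancel
    ([chi0_negId]). The same mechanism, with one conjugate only since [- Id] is
    central in [W_m], computes [chi_{lambda, mu}] at [- Id]: the index is
    [m! / (|lambda|! |mu|!)] and [sgn (- Id)] is [(-1)^|mu|]
    ([chiW_negIdW]). *)

(** * Characters induced along an embedding *)

Lemma cfunME (gT : finGroupType) (G : {group gT}) (phi psi : 'CF(G)) x :
  (phi * psi) x = phi x * psi x.
Proof. by rewrite cfunE. Qed.

Section InducedAlongEmbedding.

Variables (aT rT : finGroupType) (G : {group aT}) (f : {morphism G >-> rT}).
Variables (injf : ('injm f)%g) (phi : 'CF(G)) (g : rT).

Lemma cfIndEmb_eq0 :
  (forall y, (g ^ y)%g \notin (f @* G)%g) -> cfIndEmb injf phi g = 0.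
Proof.
move=> noconj; rewrite /cfIndEmb cfIndE ?subsetT // big1 ?mulr0 // => y _.
exact/cfun0/noconj.
Qed.

(** Frobenius' formula sums [a] over the whole of [rT] and divides by [#|G|]. *)
Lemma cfIndEmb_const a :
    (forall y, exists2 x, x \in G & f x = (g ^ y)%g /\ phi x = a) ->
  cfIndEmb injf phi g = #|[set: rT]|%:R / #|G|%:R * a.
Proof.
move=> conja; rewrite /cfIndEmb cfIndE ?subsetT // card_injm //.
rewrite (eq_bigr (fun=> a)) => [|y _].
  by rewrite sumr_const -[a *+ _]mulr_natl mulrA [_^-1 * _]mulrC.
by have [x Gx [<- <-]] := conja y; rewrite cfIsomE.
Qed.

End InducedAlongEmbedding.

(** * Orders of the groups *)

Lemma card_sdprod_by (aT rT : finGroupType)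
    (to : groupAction [set: aT] [set: rT]) :
  #|{: sdprod_by to}| = (#|{: aT}| * #|{: rT}|)%N.
Proof.
rewrite card_sub -card_prod; apply: eq_card => u.
by rewrite !inE.
Qed.

Lemma card_Cpow d n : #|{: Cpow d n}| = (#|{: rou d}| ^ n)%N.
Proof.
by rewrite card_dep_ffun foldrE big_map big_enum prod_nat_const card_ord.
Qed.

Lemma card_W n : #|[set: W n]| = (n`! * #|{: rou 2}| ^ n)%N.
Proof. by rewrite cardsT card_sdprod_by card_Sn card_Cpow. Qed.

Lemma card_Sdn d n :
  #|[set: Sdn d n]| = (n`! * (#|{: rou 2}| * #|{: rou d}|) ^ n)%N.
Proof.
by rewrite cardsT card_sdprod_by card_Cpow -cardsT card_W expnMn mulnA.
Qed.

(** This cancels the powers of the order of [C_d] from the indices below. *)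
Lemma card_rou_gt0 d : (0 < #|{: rou d}|)%N.
Proof. by rewrite -cardsT cardG_gt0. Qed.

(** * The conjugates of minus the identity *)

Lemma negIdW1 n : (negIdW n).1 = 1%g.
Proof. by rewrite /negIdW sdpair1E. Qed.

Lemma negIdW2 n i : (negIdW n).2 i = rouN1.
Proof. by rewrite /negIdW sdpair1E /= ffunE. Qed.

Lemma rouN1_neq1 : rouN1 != 1%g.
Proof.
apply/eqP=> /(congr1 (@rou_val 2)) /= /eqP.
by rewrite eq_sym -addr_eq0 (pnatr_eq0 _ 2).
Qed.

Lemma negIdW_central n (w : W n) : (w * negIdW n = negIdW n * w)%g.
Proof.
apply: sd_eq; first by rewrite /= negIdW1 mulg1 mul1g.
by apply/ffunP=> i; rewrite !W_mulE !negIdW2 negIdW1 invg1 perm1 rouC.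
Qed.

(** The shape of all conjugates of [- Id] in [C_d^n ><| W_n]. *)
Definition neg_sq d n (c : Cpow d n) : Sdn d n :=
  sdmk (actW_groupAction d n) (negIdW n) [ffun i => c i * c i]%g.

(** As [- Id] commutes with the [W_n]-component of [y] and inverts its
    [C_d^n]-component [c], conjugation by [y] contributes [c * c]. *)
Lemma negId_conj d n (y : Sdn d n) : (negId d n ^ y)%g = neg_sq y.2.
Proof.
apply: (mulgI y); rewrite conjgE mulKVg.
have neg1: (negId d n).1 = negIdW n by rewrite /negId sdpair2E.
have neg2 i : (negId d n).2 i = 1%g by rewrite /negId sdpair2E /= oneg_ffun.
apply: sd_eq; first by rewrite /= neg1 negIdW_central.
apply/ffunP=> i; rewrite !Sdn_mulE neg2 /= negIdW2 negIdW1 invg1 perm1 ffunE.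
rewrite /roupow (negPf rouN1_neq1) mulKg.
by case: ifP; rewrite ?invg1 mul1g.
Qed.

Lemma mem_SdnS d n (x : Sdn d n) : (x \in SdnS d n) = (x.1.2 == 1%g).
Proof.
apply/idP/eqP=> [/morphpreP[_ /morphimP[s _ _ xs]] | x1].
  by rewrite -[x.1]/(sdtop x) xs sdpair2E.
apply/morphpreP; split; first exact: in_setT.
apply/morphimP; exists x.1.1; rewrite ?in_setT //.
by apply: sd_eq; rewrite sdpair2E.
Qed.

(** * The hyperoctahedral characters *)

Lemma infl_negIdW lam : infl lam (negIdW (psize lam)) = specht lam 1%g.
Proof.
by rewrite /infl cfPullE ?subsetT ?in_setT //= /sdtop negIdW1.
Qed.

Lemma sgnW_negIdW k : sgnW k (negIdW k) = (-1) ^+ k.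
Proof.
rewrite /sgnW cfLinE ?in_setT // /sgn_fun rou_val_prod.
by under eq_bigr do rewrite negIdW2 /=; rewrite prodr_const card_ord.
Qed.

Lemma block_negIdW (I : finType) (p : I -> nat) n (sum_p : (\sum_i p i)%N = n)
    (w : forall i, W (p i)) :
  (forall i, w i = negIdW (p i)) -> block_W sum_p w = negIdW n.
Proof.
move=> wN; apply: sd_eq; rewrite /block_W /=.
  rewrite negIdW1; apply/permP; apply: (@block_ind _ _ _ sum_p) => i j.
  by rewrite block_permE wN negIdW1 !perm1.
apply/ffunP; apply: (@block_ind _ _ _ sum_p) => i j.
by rewrite block_tupleE wN !negIdW2.
Qed.

(** [- Id] is its only conjugate and is the image of the pair of minus
    identities, so the induced value is an index times the value at that
    pair. *)
Lemma chiW_negIdW lam mu :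
  chiW lam mu (negIdW (psize lam + psize mu)) =
    (psize lam + psize mu)`!%:R / ((psize lam)`! * (psize mu)`!)%:R
    * (-1) ^+ psize mu * specht lam 1%g * specht mu 1%g.
Proof.
set k := psize lam; set l := psize mu.
rewrite /chiW (@cfIndEmb_const _ _ _ _
  _ _ _ (specht lam 1%g * (specht mu 1%g * (-1) ^+ l))) => [|y].
  have -> : #|[set: W k * W l]| = (#|[set: W k]| * #|[set: W l]|)%N.
    by rewrite !cardsT card_prod.
  rewrite !card_W mulnACA -expnD [X in X / _]natrM [X in _ / X]natrM.
  rewrite -mulf_div divff ?mulr1; last first.
    by rewrite pnatr_eq0 -lt0n expn_gt0 card_rou_gt0.
  by rewrite -!mulrA; do 2!congr (_ * _); rewrite mulrA mulrC.
exists (negIdW k, negIdW l); first exact: in_setT.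
rewrite conjgE -negIdW_central mulKg; split.
  by apply: block_negIdW; case.
rewrite cfunME; congr (_ * _); rewrite cfPullE ?subsetT ?in_setT //=.
  exact: infl_negIdW.
by rewrite cfunME infl_negIdW sgnW_negIdW.
Qed.

(** * Empty partitions *)

Lemma psize_eq0 (lam : intpart) : (psize lam == 0%N) = (parts lam == [::]).
Proof.
case: lam => [[|a s] lamP]; rewrite /psize //=.
case/andP: (lamP) => _; rewrite inE negb_or eq_sym addn_eq0.
by move=> /andP[/negPf-> _].
Qed.

Lemma perm_S0 n (s : 'S_n) : n = 0%N -> s = 1%g.
Proof. by move=> n0; apply/permP=> i; have := ltn_ord i; rewrite {2}n0. Qed.

(** The regular module of the trivial group ['S_0] is a line, and the Young
    symmetrizer is a basis vector of it. *)
Lemma specht1_empty lam : psize lam = 0%N -> specht lam 1%g = 1.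
Proof.
move=> lam0; rewrite /specht cfRepr1.
have rank_le : (#|[set: 'S_(psize lam)]| <= 1)%N.
  by rewrite cardsT card_Sn lam0.
have all1 (A : {set 'S_(psize lam)}) : 1%g \in A -> A = [set 1%g].
  move=> A1; apply/setP=> s; rewrite (perm_S0 s lam0) A1.
  by rewrite inE eqxx.
suff u0 : young_sym lam != 0.
  apply/eqP; rewrite pnatr_eq1 eqn_leq (leq_trans (rank_leq_col _)) //.
  by rewrite lt0n mxrank_eq0 cyclic_mx_eq0.
have row1: row_stab lam = [set 1%g].
  by apply: all1; rewrite inE; apply/forallP=> k; rewrite perm1.
have col1: col_stab lam = [set 1%g].
  by apply: all1; rewrite inE; apply/forallP=> k; rewrite perm1.
rewrite /young_sym row1 big_set1 col1 big_set1.
rewrite odd_perm1 expr0 scale1r.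
by rewrite -mxrank_eq0 mxrank_delta.
Qed.

(** * The value of the main character *)

Lemma block_neg_sq d (I : finType) (p : I -> nat) n
    (sum_p : (\sum_i p i)%N = n) (c : Cpow d n) (x : forall i, Sdn d (p i)) :
    (forall i, x i = neg_sq [ffun j => c (block_pos sum_p j)]) ->
  block_Sdn sum_p x = neg_sq c.
Proof.
move=> xE; apply: sd_eq; first by apply: block_negIdW => i; rewrite xE.
apply/ffunP; apply: (@block_ind _ _ _ sum_p) => i j.
by rewrite /= block_tupleE xE /= !ffunE.
Qed.

(** [psi] raises the product of the coordinates to the power [e], and on squares
    this is the power [2 * e]. *)
Lemma psi_fun_neg_sq d m e (c : Cpow d m) :
  (d.-1.+1 %| e.*2)%N -> psi_fun e (neg_sq c) = 1.
Proof.
move=> /dvdnP[q eE]; rewrite /psi_fun rou_val_prod -prodrXl big1 // => i _.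
rewrite /= ffunE /= -expr2 -exprM mul2n eE mulnC exprM.
by rewrite (eqP (rouP (c i))) expr1n.
Qed.

Section ValueAtMinusIdentity.

Variables (d : nat) (d_even : ~~ odd d) (L : multipartition d./2.-1).
Variables (n : nat) (size_L : msize L = n).

(** A conjugate of [- Id] in the inducing subgroup would have both signs [-1]
    and [1] at the first position of the block of [lambda_j]. *)
Lemma chi0_negId_eq0 j :
  parts (lams L j) <> [::] -> chi0 d_even size_L (negId d n) = 0.
Proof.
move=> Lj; apply: cfIndEmb_eq0 => y; rewrite negId_conj.
apply/negP=> /morphimP[x _ Gx] yx.
have psizeL : (0 < psize (lams L j))%N by rewrite lt0n psize_eq0; apply/eqP.
have /= := setXnP Gx (inr j); rewrite mem_SdnS => /eqP xj.
have {}yx : neg_sq y.2 = block_Sdn (sum_bsize size_L) x by [].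
have := congr1 (fun w : Sdn d n => w.1.2 (block_pos (sum_bsize size_L)
          (Ordinal psizeL : 'I_(bsize L (inr j))))) yx.
rewrite /= negIdW2 block_tupleE xj /= oneg_ffun => N1.
by have := rouN1_neq1; rewrite N1 eqxx.
Qed.

(** The blocks of the empty partitions have size 0: their groups are trivial
    and they contribute the factor 1 to the index and to the inducing
    character. Only the two hyperoctahedral blocks remain. *)
Lemma chi0_negId :
    (forall j, parts (lams L j) = [::]) ->
  chi0 d_even size_L (negId d n) =
    n`!%:R / ((psize (lam1 L) + psize (mu1 L))`!
              * (psize (lam2 L) + psize (mu2 L))`!)%:R
    * (chiW (lam1 L) (mu1 L) (negIdW _) * chiW (lam2 L) (mu2 L) (negIdW _)).
Proof.
move=> L0; have size0 j : psize (lams L j) = 0%N.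
  by apply/eqP; rewrite psize_eq0 L0.
have SdnS_full j :
    SdnS d (psize (lams L j)) = [set: Sdn d (psize (lams L j))]%G.
  apply/val_inj/setP=> x; rewrite mem_SdnS in_setT; apply/eqP/ffunP=> i.
  by have := ltn_ord i; rewrite {2}size0.
have card1 j : #|SdnS d (psize (lams L j))| = 1%N.
  by rewrite SdnS_full card_Sdn size0.
rewrite /chi0 (@cfIndEmb_const _ _ _ _ _ _ _
  (chiW (lam1 L) (mu1 L) (negIdW _) * chiW (lam2 L) (mu2 L) (negIdW _)))
    => [|y].
  congr (_ * _); set G := setXn_group _.
  have -> : #|G| = (((psize (lam1 L) + psize (mu1 L))`!
              * (psize (lam2 L) + psize (mu2 L))`!) *
    (#|{: rou 2}| * #|{: rou d}|) ^ n)%N.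
    rewrite cardsXn big_sumType big_bool /= [X in (_ * X)%N]big1 => [|j _].
      rewrite !card_Sdn muln1 mulnACA -expnD; congr (_ * _ ^ _)%N.
      by rewrite -size_L /msize big1 ?addn0 ?addnA.
    exact: card1.
  rewrite card_Sdn [X in X / _]natrM [X in _ / X]natrM.
  rewrite -mulf_div divff ?mulr1 // pnatr_eq0 -lt0n expn_gt0 muln_gt0.
  by rewrite !card_rou_gt0.
pose x : {dffun forall i, Sdn d (bsize L i)} :=
  [ffun i => neg_sq [ffun j => y.2 (block_pos (sum_bsize size_L) j)]].
have Gx : x \in setXn (bgroup L).
  apply/setXnP=> -[b | j]; first exact: in_setT.
  by rewrite -[bgroup L _]/(SdnS d (psize (lams L j))) SdnS_full in_setT.
exists x => //; split.
  by rewrite negId_conj; apply: block_neg_sq => i; rewrite ffunE.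
rewrite prod_cfunE // big_sumType big_bool /= [X in _ * X]big1 => [|j _].
  rewrite !cfPullE ?subsetT ?in_setT //= mulr1 !cfunME !ffunE.
  rewrite /inflW !cfPullE ?subsetT ?in_setT //= /psiW !cfLinE ?in_setT //.
  by rewrite !psi_fun_neg_sq ?psi1_dvd ?psi2_dvd // !mulr1.
have Sx : x (inr j) \in SdnS d (psize (lams L j)) by rewrite SdnS_full in_setT.
have sGS : (dffun_morphism (fun i => Sdn d (bsize L i)) (inr j)
              @* setXn (bgroup L))%g \subset SdnS d (psize (lams L j)).
  by have := morphim_dffunXn (inr j) (bgroup L) => /= ->.
rewrite cfPullE ?subsetT //.
rewrite cfunME /inflW /psiS cfLinE // cfPullE ?subsetT //=.
rewrite /infl cfPullE ?subsetT ?in_setT //=.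
rewrite (perm_S0 (sdtop _) (size0 j)) specht1_empty // mul1r.
rewrite /psi_fun rou_val_prod big1 ?expr1n // => i _.
by have := ltn_ord i; rewrite {2}size0.
Qed.

End ValueAtMinusIdentity.

Theorem mainTheorem7 (d : nat) (d_gt0 : (0 < d)%N) (d_even : ~~ odd d)
    (n : nat) (L : multipartition d./2.-1) (size_L : msize L = n) :
  ((exists j, parts (lams L j) <> [::]) ->
     chi0 d_even size_L (negId d n) = 0)
  /\
  ((forall j, parts (lams L j) = [::]) ->
     chi0 d_even size_L (negId d n) =
       (n`!)%:R / ((psize (lam1 L))`! * (psize (mu1 L))`!
                   * (psize (lam2 L))`! * (psize (mu2 L))`!)%:R
       * (-1) ^+ (psize (mu1 L) + psize (mu2 L))
       * specht (lam1 L) 1%g * specht (mu1 L) 1%g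
       * specht (lam2 L) 1%g * specht (mu2 L) 1%g).
Proof.
split=> [[j] | L0]; first exact: chi0_negId_eq0.
rewrite chi0_negId // !chiW_negIdW exprD.
have fact_neq0 m : m`!%:R != 0 :> algC by rewrite pnatr_eq0 -lt0n fact_gt0.
rewrite !natrM; field; rewrite !fact_neq0 //.
Qed.
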